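(* For every integer $n\ge2$, the Bernoulli number $b_n$ of the second kind is given by $$b_n=(-1)^n\frac1{n!}\Biggl(\frac1{n+1}+\sum_{k=2}^{n} \frac{a_{n,k}-n\,a_{n-1,k}}{k!}\Biggr).$$
   Context: The Bernoulli numbers of the second kind $b_0,b_1,b_2,\dots$ are defined by the power series expansion about $x=0$ $$\frac{x}{\ln(1+x)}=\sum_{n=0}^\infty b_nx^n.$$ For integers $n\ge1$ and $2\le i\le n+1$, the coefficients $a_{n,i}$ are defined by $a_{n,2}=(n-1)!$ and, for $3\le i\le n+1$, $$a_{n,i}=(i-1)!\,(n-1)!\sum_{\ell_1=1}^{n-1} \frac1{\ell_1}\sum_{\ell_2=1}^{\ell_1-1}\frac1{\ell_2}\dotsm \sum_{\ell_{i-2}=1}^{\ell_{i-3}-1}\frac1{\ell_{i-2}},$$ a nested sum of depth $i-2$, i.e. the sum of $\frac{1}{\ell_1\cdots\ell_{i-2}}$ over all integers $n-1\ge\ell_1>\dots>\ell_{i-2}\ge1$. *)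

(* Defs.v *)
From Stdlib Require Import Reals Arith Factorial Lra Lia.
From Coquelicot Require Import Coquelicot.
Open Scope R_scope.

(** [b] is the sequence of coefficients of the power series expansion of
    [x / ln (1 + x)] about [0].  The point [x = 0] is excluded: there the
    function is understood as its limit, whereas [0 / ln (1 + 0)] is [0]
    in [R]. *)
Definition bernoulli_second_kind (b : nat -> R) : Prop :=
  exists r : R, 0 < r /\
    forall x : R, 0 < Rabs x < r -> is_pseries b x (x / ln (1 + x)).

(** Sum of [1 / (l_1 * ... * l_d)] over [m - 1 >= l_1 > ... > l_d >= 1],
    for [m >= 1]; [sum_n_m] is zero when its range is empty. *)
Fixpoint nested_sum (d m : nat) : R :=
  match d with
  | O => 1
  | S d' => sum_n_m (fun l => 1 / INR l * nested_sum d' l) 1 (m - 1)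
  end.

(** Only meant for [n >= 1] and [2 <= i <= n + 1]. *)
Definition a_coeff (n i : nat) : R :=
  if Nat.eqb i 2 then INR (fact (n - 1))
  else INR (fact (i - 1)) * INR (fact (n - 1)) * nested_sum (i - 2) n.

(** Existence of the expansion, so that [bernoulli_second_kind] is inhabited. *)

Definition ln_coeff (n : nat) : R := (-1) ^ n / INR (S n).

Lemma geom_radius (a : nat -> R) (q : R) :
  0 < q -> (forall n, Rabs (a n) <= (/ q) ^ n) -> Rbar_le q (CV_radius a).
Proof.
intros Hq Ha.
apply (proj1 (CV_radius_bounded a)).
exists 1; intros n.
rewrite Rabs_mult, <- RPow_abs, (Rabs_pos_eq q) by lra.
apply Rle_trans with ((/ q) ^ n * q ^ n).
- apply Rmult_le_compat_r; [apply pow_le; lra | apply Ha].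
- rewrite <- Rpow_mult_distr, Rinv_l, pow1 by lra. lra.
Qed.

Lemma alternating_radius : Rbar_le 1 (CV_radius (fun n => (-1) ^ n)).
Proof.
apply geom_radius; [lra | intros n].
rewrite pow_1_abs, Rinv_1, pow1; lra.
Qed.

Lemma ln_coeff_bound n : Rabs (ln_coeff n) <= / INR (S n).
Proof.
unfold ln_coeff, Rdiv.
rewrite Rabs_mult, pow_1_abs, Rmult_1_l, Rabs_pos_eq; [lra |].
left; apply Rinv_0_lt_compat, lt_0_INR; lia.
Qed.

Lemma ln_coeff_radius : Rbar_le 1 (CV_radius ln_coeff).
Proof.
apply geom_radius; [lra | intros n].
eapply Rle_trans; [apply ln_coeff_bound |].
rewrite Rinv_1, pow1, <- Rinv_1.
apply Rinv_le_contravar; [lra |].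
rewrite S_INR; generalize (pos_INR n); lra.
Qed.

Lemma PSeries_alternating x :
  Rabs x < 1 -> PSeries (fun n => (-1) ^ n) x = / (1 + x).
Proof.
intros Hx.
apply is_pseries_unique, is_pseries_R.
apply is_series_ext with (fun n => (- x) ^ n).
- intros n. rewrite <- Rpow_mult_distr. f_equal; ring.
- replace (/ (1 + x)) with (/ (1 - - x)) by (f_equal; ring).
  apply is_series_geom. now rewrite Rabs_Ropp.
Qed.

Lemma ln_expansion x :
  0 < Rabs x < 1 -> is_pseries ln_coeff x (ln (1 + x) / x).
Proof.
intros [H0 H1].
assert (Hx : x <> 0) by (intros ->; rewrite Rabs_R0 in H0; lra).
apply Rabs_lt_between in H1 as H1'.
assert (H : is_pseries (PS_Int (fun n => (-1) ^ n)) x (ln (1 + x))).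
{ replace (ln (1 + x)) with (RInt (PSeries (fun n => (-1) ^ n)) 0 x).
  - apply is_pseries_RInt.
    apply (Rbar_lt_le_trans _ 1); [exact H1 | apply alternating_radius].
  - assert (Hin : forall y, Rmin 0 x <= y <= Rmax 0 x -> -1 < y < 1).
    { intros y; unfold Rmin, Rmax; destruct (Rle_dec 0 x); lra. }
    rewrite (RInt_ext _ (fun y => / (1 + y))).
    2: { intros y Hy. apply PSeries_alternating, Rabs_lt_between, Hin; lra. }
    replace (ln (1 + x)) with (minus (ln (1 + x)) (ln (1 + 0))).
    2: { rewrite Rplus_0_r, ln_1. unfold minus, plus, opp; simpl; ring. }
    apply is_RInt_unique.
    apply (is_RInt_derive (fun y => ln (1 + y))).
    + intros y Hy%Hin. auto_derive; [lra | field; lra].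
    + intros y Hy%Hin. apply (ex_derive_continuous (fun y => / (1 + y))).
      auto_derive; lra. }
apply (is_pseries_decr_1 _ x (/ x)) in H; [| apply Rinv_l, Hx].
replace (ln (1 + x) / x) with
  (scal (/ x) (plus (ln (1 + x)) (opp (PS_Int (fun n => (-1) ^ n) 0%nat)))).
- exact H.
- unfold scal, plus, opp; simpl; unfold mult; simpl. field. exact Hx.
Qed.

(** Coefficients of the inverse of the power series with coefficients
    [ln_coeff]; [recip_prefix n] is correct on the indices up to [n]. *)
Fixpoint recip_prefix (n : nat) : nat -> R :=
  match n with
  | O => fun _ => 1
  | S n' => fun k =>
      if Nat.leb k n' then recip_prefix n' k
      else - sum_f_R0 (fun j => recip_prefix n' j * ln_coeff (S n' - j)) n'
  end.

Definition recip (n : nat) : R := recip_prefix n n.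

Lemma recip_prefixE n k : (k <= n)%nat -> recip_prefix n k = recip k.
Proof.
induction n as [|n IH]; intros Hk.
- now replace k with 0%nat by lia.
- destruct (Nat.eq_dec k (S n)) as [->|Hne]; [reflexivity |].
  simpl. destruct (Nat.leb_spec k n); [apply IH |]; lia.
Qed.

Lemma recipS n :
  recip (S n) = - sum_f_R0 (fun j => recip j * ln_coeff (S n - j)) n.
Proof.
unfold recip at 1; cbn [recip_prefix].
destruct (Nat.leb_spec (S n) n); [lia |].
f_equal. apply sum_eq. intros j Hj. now rewrite recip_prefixE.
Qed.

Lemma recip_mult n :
  PS_mult recip ln_coeff n = match n with O => 1 | S _ => 0 end.
Proof.
destruct n as [|n]; unfold PS_mult.
- unfold recip, ln_coeff; simpl. field.
- rewrite tech5, Nat.sub_diag, (recipS n).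
  replace (ln_coeff 0) with 1 by (unfold ln_coeff; simpl; field). ring.
Qed.

Lemma recip_bound n : Rabs (recip n) <= 2 ^ n.
Proof.
induction n as [n IH] using (well_founded_induction Nat.lt_wf_0).
destruct n as [|n].
- unfold recip; simpl. rewrite Rabs_R1; lra.
- rewrite recipS, Rabs_Ropp.
  eapply Rle_trans; [apply Rsum_abs |].
  apply Rle_trans with (sum_f_R0 (fun j => 2 ^ j) n).
  + apply sum_Rle. intros j Hj. rewrite Rabs_mult.
    rewrite <- (Rmult_1_r (2 ^ j)).
    apply Rmult_le_compat; try apply Rabs_pos; [apply IH; lia |].
    eapply Rle_trans; [apply ln_coeff_bound |].
    rewrite <- Rinv_1. apply Rinv_le_contravar; [lra |].
    rewrite S_INR; generalize (pos_INR (S n - j)); lra.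
  + rewrite tech3 by lra. generalize (pow_lt 2 (S n)); lra.
Qed.

Lemma bernoulli_second_kind_exists : exists b, bernoulli_second_kind b.
Proof.
exists recip, (/ 2). split; [lra | intros x [H0 H1]].
assert (Hx : x <> 0) by (intros ->; rewrite Rabs_R0 in H0; lra).
assert (Hr : Rbar_lt (Rabs x) (CV_radius recip)).
{ apply (Rbar_lt_le_trans _ (/ 2)); [exact H1 | apply geom_radius; [lra |]].
  intros n. rewrite Rinv_inv. apply recip_bound. }
assert (Hl : Rbar_lt (Rabs x) (CV_radius ln_coeff)).
{ apply (Rbar_lt_le_trans _ 1); [simpl; lra | apply ln_coeff_radius]. }
assert (Hln : is_pseries ln_coeff x (ln (1 + x) / x))
  by (apply ln_expansion; lra).
assert (Hb := PSeries_correct _ _ (CV_radius_inside _ _ Hr)).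
assert (E : PSeries recip x * (ln (1 + x) / x) = 1).
{ rewrite <- (is_pseries_unique _ _ _ (is_pseries_mult _ _ _ _ _ Hb Hln Hr Hl)).
  rewrite (PSeries_ext _ _ x recip_mult).
  apply is_pseries_unique, is_pseries_R.
  apply is_series_decr_1.
  apply is_series_ext with (fun _ => 0); [intros n; simpl; ring |].
  match goal with |- is_series _ ?l => replace l with 0 end.
  - change (is_lim_seq (sum_n (fun _ => 0)) 0).
    apply is_lim_seq_ext with (fun _ => 0); [| apply is_lim_seq_const].
    intros n. rewrite sum_n_const. ring.
  - unfold plus, opp; simpl; ring. }
assert (Hl0 : ln (1 + x) <> 0).
{ intros Z. rewrite Z in E. unfold Rdiv in E. lra. }
replace (x / ln (1 + x)) with (PSeries recip x); [exact Hb |].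
replace (PSeries recip x) with
  (PSeries recip x * (ln (1 + x) / x) * (x / ln (1 + x))) by (field; tauto).
rewrite E; ring.
Qed.

(* Main.v *)
(** Both sides equal the integral of [y (y - 1) ... (y - n + 1) / n!] over
    [[0, 1]].  On the left, the derivative of [binom_poly (n + 1)] is
    [sum_(k <= n) binom_poly k * (-1)^(n-k) / (n-k+1)], so the integrals of the
    [binom_poly k] over [[0, 1]] satisfy the recurrence that determines the
    coefficients of the reciprocal of [ln (1 + x) / x].  On the right,
    [a_(n,k) / k!] is [1 / k] times the coefficient of [y^(k-1)] in the rising
    factorial [y (y + 1) ... (y + n - 1)], and the substitution [y := 1 - y]
    turns the falling factorial into a difference of rising ones. *)
Require Import Defs.
From Stdlib Require Import Reals Factorial.
From Coquelicot Require Import Coquelicot.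
From Stdlib Require Import Arith Lra Lia.
Open Scope R_scope.

(** * Binomial polynomials: derivative and integral over [0, 1] *)

Fixpoint binom_poly (n : nat) (y : R) : R :=
  match n with
  | O => 1
  | S n' => binom_poly n' y * (y - INR n') / INR (S n')
  end.

Fixpoint rising (n : nat) (y : R) : R :=
  match n with
  | O => 1
  | S n' => rising n' y * (y + INR n')
  end.

Lemma INR_S_neq0 n : INR (S n) <> 0.
Proof. apply not_0_INR; lia. Qed.

Lemma is_RInt_sum_f_R0 (f : nat -> R -> R) (I : nat -> R) (a b : R) (n : nat) :
  (forall k, (k <= n)%nat -> is_RInt (f k) a b (I k)) ->
  is_RInt (fun y => sum_f_R0 (fun k => f k y) n) a b (sum_f_R0 I n).
Proof.
induction n as [|n IH]; intros H.
- apply H; lia.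
- simpl. apply (is_RInt_plus (V := R_NormedModule)); [apply IH; intros; apply H|apply H]; lia.
Qed.

Lemma continuous_sum_f_R0 (f : nat -> R -> R) (n : nat) (x : R) :
  (forall k, continuous (f k) x) ->
  continuous (fun y => sum_f_R0 (fun k => f k y) n) x.
Proof.
intros H. induction n as [|n IH]; [apply H |].
simpl. now apply (continuous_plus (V := R_NormedModule)).
Qed.

(** Differentiating the generating function [(1 + x)^y] in [y] multiplies it by [ln (1 + x)]. The
    proof avoids generating functions: induction on [n], with the product rule applied to the
    recursive definition. *)
Lemma is_derive_binom_poly n y :
  is_derive (binom_poly (S n)) y
    (sum_f_R0 (fun k => binom_poly k y * ln_coeff (n - k)) n).
Proof.
induction n as [|n IH].
- simpl. unfold ln_coeff; simpl. auto_derive; [trivial | field].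
- set (D := sum_f_R0 (fun k => binom_poly k y * ln_coeff (n - k)) n) in IH.
  assert (E : sum_f_R0 (fun k => binom_poly k y * ln_coeff (S n - k)) (S n)
    = (D * (y - INR (S n)) + binom_poly (S n) y) / INR (S (S n))).
  (* Writing [B_k] for [binom_poly k y], one has [B_k (y - (n+1)) = (k+1) B_(k+1) - (n+1-k) B_k].
     With [Z], the sum telescopes and leaves only the boundary term in [B_(m+1)]. *)
  { assert (P : forall m, (m <= n)%nat ->
      INR (S (S n)) *
        sum_f_R0 (fun k => binom_poly k y * ln_coeff (S n - k)) m =
      sum_f_R0 (fun k => binom_poly k y * ln_coeff (n - k)) m
        * (y - INR (S n))
      - INR (S m) * binom_poly (S m) y * ln_coeff (n - m)).
    (* Both sides are [(-1)^(n+1-k)]. *)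
    { assert (L : forall k, (k <= n)%nat ->
        INR (S (S n) - k) * ln_coeff (S n - k)
        = - (INR (S n - k) * ln_coeff (n - k))).
      { intros k Hk. unfold ln_coeff.
        replace (S (S n) - k)%nat with (S (S n - k)) by lia.
        replace (S n - k)%nat with (S (n - k)) by lia.
        cbn [pow]. field. split; apply INR_S_neq0. }
      assert (Z : forall k, (k <= n)%nat ->
        INR (S (S n)) * ln_coeff (S n - k) =
        INR k * ln_coeff (S n - k) - (INR (S n) - INR k) * ln_coeff (n - k)).
      { intros k Hk. specialize (L k Hk).
        rewrite !minus_INR in L by lia. lra. }
      induction m as [|m IHm]; intros Hm.
      - assert (Z0 := Z 0%nat Hm). cbn [sum_f_R0]. rewrite !Nat.sub_0_r in Z0 |- *.
        change (INR 0) with 0 in Z0.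
        cbn [binom_poly]. change (INR 0) with 0; change (INR 1) with 1.
        transitivity (INR (S (S n)) * ln_coeff (S n)); [ring|].
        rewrite Z0. field.
      - rewrite !tech5, Rmult_plus_distr_l, IHm by lia.
        assert (Zm := Z (S m) Hm).
        replace (S n - S m)%nat with (n - m)%nat in * by lia.
        change (binom_poly (S (S m)) y)
          with (binom_poly (S m) y * (y - INR (S m)) / INR (S (S m))).
        set (B := binom_poly (S m) y) in *.
        transitivity (sum_f_R0 (fun k => binom_poly k y * ln_coeff (n - k)) m
           * (y - INR (S n)) - INR (S m) * B * ln_coeff (n - m)
           + B * (INR (S (S n)) * ln_coeff (n - m))); [ring|].
        rewrite Zm. field. apply INR_S_neq0. }
    (* At [m = n] the boundary term is [-(n+1) B_(n+1)]; the last summand adds [(n+2) B_(n+1)], so a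
       single [B_(n+1)] remains. *)
    apply Rmult_eq_reg_l with (INR (S (S n))); [|apply INR_S_neq0].
    rewrite tech5, Rmult_plus_distr_l, P by lia. fold D.
    rewrite !Nat.sub_diag. replace (ln_coeff 0) with 1 by (unfold ln_coeff; simpl; field).
    rewrite (S_INR (S n)). field. rewrite <- S_INR. apply INR_S_neq0. }
  rewrite E.
  apply (is_derive_ext (fun y => binom_poly (S n) y * (y - INR (S n)) / INR (S (S n))));
    [reflexivity|].
  generalize (INR (S n)) as u, (INR (S (S n))) as v; intros u v.
  revert IH; generalize (binom_poly (S n)) as f; intros f IH.
  auto_derive.
  + now exists D.
  + change (Derive (fun x => f x) y) with (Derive f y).
    rewrite (is_derive_unique _ _ _ IH). unfold Rdiv; ring.
Qed.

Lemma continuous_binom_poly n y : continuous (binom_poly n) y.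
Proof.
destruct n as [|n].
- apply continuous_const.
- apply (ex_derive_continuous (V := R_NormedModule)).
  eexists. apply is_derive_binom_poly.
Qed.

Lemma is_RInt_binom_poly n a b :
  is_RInt (binom_poly n) a b (RInt (binom_poly n) a b).
Proof.
apply (RInt_correct (V := R_CompleteNormedModule)), (ex_RInt_continuous (V := R_CompleteNormedModule)).
intros y _. apply continuous_binom_poly.
Qed.

Lemma binom_poly_0 n : binom_poly (S n) 0 = 0.
Proof.
induction n as [|n IH]; [simpl; field|].
change (binom_poly (S n) 0 * (0 - INR (S n)) / INR (S (S n)) = 0).
rewrite IH. unfold Rdiv; ring.
Qed.

Lemma binom_poly_1 n : binom_poly (S (S n)) 1 = 0.
Proof.
induction n as [|n IH]; [simpl; field|].
change (binom_poly (S (S n)) 1 * (1 - INR (S (S n))) / INR (S (S (S n))) = 0).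
rewrite IH. unfold Rdiv; ring.
Qed.

(** The convolution is the integral of the derivative of [binom_poly (S n)], hence a difference of
    end values. These all vanish except the value 1 of [binom_poly 1] at 1. *)
Lemma RInt_binom_poly_mult n :
  PS_mult (fun k => RInt (binom_poly k) 0 1) ln_coeff n
  = match n with O => 1 | S _ => 0 end.
Proof.
unfold PS_mult.
transitivity (minus (binom_poly (S n) 1) (binom_poly (S n) 0)).
- assert (H1 : is_RInt (fun y => sum_f_R0 (fun k => binom_poly k y * ln_coeff (n - k)) n)
    0 1 (sum_f_R0 (fun k => RInt (binom_poly k) 0 1 * ln_coeff (n - k)) n)).
  { apply (is_RInt_sum_f_R0 (fun k y => binom_poly k y * ln_coeff (n - k))).
    intros k _. rewrite Rmult_comm.
    apply is_RInt_ext with (fun y => scal (ln_coeff (n - k)) (binom_poly k y)).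
    - intros y _. unfold scal; simpl; unfold mult; simpl; ring.
    - apply (is_RInt_scal (V := R_NormedModule)), is_RInt_binom_poly. }
  rewrite <- (is_RInt_unique _ _ _ _ H1). apply is_RInt_unique.
  apply (is_RInt_derive (binom_poly (S n))).
  + intros y _. apply is_derive_binom_poly.
  + intros y _.
    apply (continuous_sum_f_R0 (fun k y => binom_poly k y * ln_coeff (n - k))).
    intros k.
    apply (continuous_mult (K := R_AbsRing) (binom_poly k) (fun _ => ln_coeff (n - k)));
      [apply continuous_binom_poly | apply continuous_const].
- change (binom_poly (S n) 1 - binom_poly (S n) 0 = match n with O => 1 | S _ => 0 end).
  rewrite binom_poly_0.
  destruct n as [|n]; [simpl; field | rewrite binom_poly_1; ring].
Qed.

(** * Identifying the coefficients of an inverse power series *)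

(** Outside the disk of convergence the terms do not tend to 0, as those of a convergent series
    must. *)
Lemma CV_radius_ge_ex_pseries (a : nat -> R) (x : R) :
  ex_pseries a x -> Rbar_le (Rabs x) (CV_radius a).
Proof.
intros H. apply Rbar_not_lt_le. intros Hlt.
apply (CV_disk_outside a x Hlt).
apply (ex_series_lim_0 (fun n => a n * x ^ n)).
now apply ex_pseries_R.
Qed.

(** Near 0 the product of [x / ln (1 + x)] and [ln (1 + x) / x] is 1, and power series expansions
    are unique. *)
Lemma bernoulli_second_kind_mult b :
  bernoulli_second_kind b ->
  forall n, PS_mult b ln_coeff n = match n with O => 1 | S _ => 0 end.
Proof.
intros [r [Hr Hb]].
set (delta := fun n : nat => match n with O => 1 | S _ => 0 end).
(* The cap at 1 keeps [x] where the logarithm series converges; halving gives a point strictly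
   inside the punctured disk of [Hb]. *)
assert (Rb : Rbar_le (Rmin r 1 / 2) (CV_radius b)).
{ assert (0 < Rmin r 1 <= r) by (unfold Rmin; destruct (Rle_dec r 1); lra).
  rewrite <- (Rabs_pos_eq (Rmin r 1 / 2)) by lra.
  apply CV_radius_ge_ex_pseries. eexists. apply Hb. rewrite Rabs_pos_eq; lra. }
assert (Rd : Rbar_le 1 (CV_radius delta)).
{ apply geom_radius; [lra|]. intros [|k]; rewrite Rinv_1, pow1; simpl;
    [rewrite Rabs_R1|rewrite Rabs_R0]; lra. }
(* Multiplying by [x] makes the identity of functions hold at [x = 0] too. *)
assert (Hd : forall x, Rabs x < Rmin r 1 / 2 ->
  PSeries (PS_incr_1 (PS_mult b ln_coeff)) x = PSeries (PS_incr_1 delta) x).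
{ intros x Hx.
  assert (Hm1 := Rmin_r r 1). assert (Hm2 := Rmin_l r 1).
  rewrite !PSeries_incr_1.
  destruct (Req_dec x 0) as [->|Hx0]; [ring|].
  assert (Hxp := Rabs_pos_lt x Hx0).
  f_equal.
  assert (H1 : Rbar_lt (Rabs x) (CV_radius b)).
  { eapply Rbar_lt_le_trans; [|exact Rb]; exact Hx. }
  assert (H2 : Rbar_lt (Rabs x) (CV_radius ln_coeff)).
  { eapply Rbar_lt_le_trans; [|exact ln_coeff_radius]. simpl; lra. }
  rewrite PSeries_mult by assumption.
  rewrite (is_pseries_unique _ _ _ (Hb x ltac:(lra))).
  rewrite (is_pseries_unique _ _ _ (ln_expansion x ltac:(lra))).
  rewrite (PSeries_decr_1 delta).
  - rewrite (PSeries_ext (PS_decr_1 delta) (fun _ => 0)) by reflexivity.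
    rewrite PSeries_const_0. simpl.
    assert (ln (1 + x) <> 0).
    { apply Rabs_lt_between in Hx. intros Hl. apply Hx0.
      assert (1 + x = 1); [|lra]. apply ln_inv; [lra|lra|]. now rewrite ln_1. }
    field. now split.
  - apply CV_radius_inside. eapply Rbar_lt_le_trans; [|exact Rd]. simpl; lra. }
assert (Hpos : 0 < Rmin r 1 / 2) by (unfold Rmin; destruct (Rle_dec r 1); lra).
intros n.
(* Multiplication by [x] has shifted coefficient [n] to index [S n]. *)
apply (PSeries_ext_recip (PS_incr_1 (PS_mult b ln_coeff)) (PS_incr_1 delta) (S n)).
- rewrite CV_radius_incr_1.
  apply Rbar_lt_le_trans with (Rabs (Rmin r 1 / 4)); [apply Rabs_pos_lt; lra|].
  apply CV_radius_ge_ex_pseries.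
  assert (Hm := Rmin_r r 1).
  apply ex_pseries_mult; rewrite Rabs_pos_eq by lra;
    eapply Rbar_lt_le_trans; [|exact Rb| |exact ln_coeff_radius]; simpl; lra.
- rewrite CV_radius_incr_1. apply Rbar_lt_le_trans with 1; [simpl; lra | exact Rd].
- exists (mkposreal _ Hpos). intros x Hx. apply Hd.
  unfold ball in Hx; simpl in Hx; unfold AbsRing_ball, abs, minus, plus, opp in Hx; simpl in Hx.
  now rewrite Ropp_0, Rplus_0_r in Hx.
Qed.

(** By strong induction the two convolutions at [n] differ only in their last terms, [a n * c 0] and
    [b n * c 0]. *)
Lemma PS_mult_inj (a b c : nat -> R) :
  c 0%nat <> 0 -> (forall n, PS_mult a c n = PS_mult b c n) ->
  forall n, a n = b n.
Proof.
intros Hc H n.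
induction n as [n IH] using (well_founded_induction Nat.lt_wf_0).
specialize (H n). unfold PS_mult in H.
destruct n as [|n].
- simpl in H. now apply Rmult_eq_reg_r in H.
- rewrite !tech5, Nat.sub_diag in H.
  rewrite (sum_eq _ (fun k => b k * c (S n - k)%nat)) in H.
  + apply Rplus_eq_reg_l in H. now apply Rmult_eq_reg_r in H.
  + intros k Hk. rewrite IH by lia. reflexivity.
Qed.

(** * Nested sums as coefficients of rising factorials *)

(** The added term collects the tuples with largest index [S n]. Up to factorials this is the
    recurrence of the unsigned Stirling numbers of the first kind. *)
Lemma nested_sum_S d n :
  nested_sum (S d) (S (S n)) =
  nested_sum (S d) (S n) + / INR (S n) * nested_sum d (S n).
Proof.
cbn [nested_sum].
replace (S (S n) - 1)%nat with (S n) by lia.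
replace (S n - 1)%nat with n by lia.
rewrite sum_n_Sm by lia. unfold plus; simpl plus.
unfold Rdiv at 2; rewrite Rmult_1_l. reflexivity.
Qed.

Lemma nested_sum_1 d : nested_sum (S d) 1 = 0.
Proof. simpl. now rewrite sum_n_m_zero by lia. Qed.

(** The only strictly decreasing [n]-tuple in [1..n] is [n, ..., 1], and there is no longer one. The
    induction for the first claim uses the second. *)
Lemma nested_sum_diag n : INR (fact n) * nested_sum n (S n) = 1
  /\ forall d, (n < d)%nat -> nested_sum d (S n) = 0.
Proof.
induction n as [|n [IH1 IH2]].
- split; [simpl; ring|]. intros [|d] Hd; [lia|apply nested_sum_1].
- split.
  + rewrite nested_sum_S, (IH2 (S n)), fact_simpl, mult_INR by lia.
    rewrite <- IH1. field. apply INR_S_neq0.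
  + intros [|d] Hd; [lia|]. rewrite nested_sum_S, !IH2 by lia. ring.
Qed.

(** The upper limit [N] is free because the summands beyond [n] vanish; the induction step needs the
    hypothesis at both [N] and [S N]. *)
Lemma rising_expansion n N y : (n <= N)%nat ->
  rising (S n) y =
  INR (fact n) * sum_f_R0 (fun d => nested_sum d (S n) * y ^ S d) N.
Proof.
revert N; induction n as [|n IH]; intros N HN.
- clear HN. induction N as [|N IHN]; [simpl; ring|].
  rewrite tech5, nested_sum_1, IHN. ring.
- destruct N as [|N]; [lia|].
  (* This is [nested_sum_S] summed over [d]; the factor [y] accounts for the shift of [d] by one. *)
  assert (E : sum_f_R0 (fun d => nested_sum d (S (S n)) * y ^ S d) (S N) =
    sum_f_R0 (fun d => nested_sum d (S n) * y ^ S d) (S N)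
    + y / INR (S n) * sum_f_R0 (fun d => nested_sum d (S n) * y ^ S d) N).
  { clear. induction N as [|N IHN].
    - rewrite !tech5, nested_sum_S. cbn [sum_f_R0]. simpl nested_sum. cbn [pow].
      field. apply INR_S_neq0.
    - rewrite tech5, IHN, nested_sum_S, !tech5. cbn [pow].
      field. apply INR_S_neq0. }
  rewrite E, fact_simpl, mult_INR.
  change (rising (S n) y * (y + INR (S n)) = INR (S n) * INR (fact n) *
   (sum_f_R0 (fun d => nested_sum d (S n) * y ^ S d) (S N) +
    y / INR (S n) * sum_f_R0 (fun d => nested_sum d (S n) * y ^ S d) N)).
  set (A := sum_f_R0 _ (S N)). set (B := sum_f_R0 _ N).
  transitivity (INR (S n) * (INR (fact n) * A) + y * (INR (fact n) * B)).
  + unfold A, B. rewrite <- !IH by lia. ring.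
  + field. apply INR_S_neq0.
Qed.

Lemma is_RInt_rising n N : (n <= N)%nat ->
  is_RInt (rising (S n)) 0 1
    (INR (fact n) * sum_f_R0 (fun d => nested_sum d (S n) / INR (S (S d))) N).
Proof.
intros HN.
apply is_RInt_ext with (fun y => scal (INR (fact n))
  (sum_f_R0 (fun d => nested_sum d (S n) * y ^ S d) N)).
{ intros y _. now rewrite (rising_expansion n N). }
apply (is_RInt_scal (V := R_NormedModule)).
apply (is_RInt_sum_f_R0 (fun d y => nested_sum d (S n) * y ^ S d)).
intros d _. apply (is_RInt_scal (V := R_NormedModule)).
replace (/ INR (S (S d))) with
  (minus (1 ^ S (S d) / INR (S (S d))) (0 ^ S (S d) / INR (S (S d)))).
- apply (is_RInt_derive (fun y => y ^ S (S d) / INR (S (S d)))).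
  + intros y _. assert (H := INR_S_neq0 (S d)). auto_derive; [trivial|].
    cbn [Nat.pred]. simpl pow. field. exact H.
  + intros y _. apply (ex_derive_continuous (V := R_NormedModule)). auto_derive; trivial.
- rewrite pow1, pow_i by lia.
  change (1 / INR (S (S d)) - 0 / INR (S (S d)) = / INR (S (S d))).
  field. apply INR_S_neq0.
Qed.

(** * Reflection [y := 1 - y] and the final formula *)

(** Changing the sign of each factor of the falling factorial at [1 - y] leaves
    [(y - 1) * rising n y], and [y - 1 = (y + n) - (n + 1)]. *)
Lemma binom_poly_reflect n y :
  INR (fact (S n)) * binom_poly (S n) (1 - y) =
  (-1) ^ S n * (rising (S n) y - INR (S n) * rising n y).
Proof.
induction n as [|n IH]; [simpl; field|].
change (binom_poly (S (S n)) (1 - y)) with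
  (binom_poly (S n) (1 - y) * (1 - y - INR (S n)) / INR (S (S n))).
rewrite fact_simpl, mult_INR.
transitivity (INR (fact (S n)) * binom_poly (S n) (1 - y) * (1 - y - INR (S n))).
- field. apply INR_S_neq0.
- rewrite IH. cbn [rising]. rewrite !S_INR. cbn [pow]. ring.
Qed.

Lemma is_RInt_binom_poly_reflect n :
  is_RInt (fun y => binom_poly n (1 - y)) 0 1 (RInt (binom_poly n) 0 1).
Proof.
(* The substitution reverses the interval, hence the [opp]; the factor -1 it also produces cancels
   that sign. *)
assert (H := is_RInt_comp_lin (V := R_NormedModule) (binom_poly n) (-1) 1 0 1
  (opp (RInt (binom_poly n) 0 1))).
replace (-1 * 0 + 1) with 1 in H by ring.
replace (-1 * 1 + 1) with 0 in H by ring.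
specialize (H (is_RInt_swap _ _ _ _ (is_RInt_binom_poly _ _ _))).
apply (is_RInt_opp (V := R_NormedModule)) in H. rewrite opp_opp in H.
apply is_RInt_ext with (2 := H).
intros y _.
change (- (-1 * binom_poly n (-1 * y + 1)) = binom_poly n (1 - y)).
replace (-1 * y + 1) with (1 - y) by ring. ring.
Qed.

(** Since [(i-1)! / i! = 1 / i]; the separate case [i = 2] fits the general formula because the
    nested sum of depth 0 is 1. *)
Lemma a_coeffE n d :
  a_coeff (S n) (S (S d)) / INR (fact (S (S d)))
  = INR (fact n) * (nested_sum d (S n) / INR (S (S d))).
Proof.
unfold a_coeff. replace (S n - 1)%nat with n by lia.
assert (E : INR (fact (S (S d))) = INR (S (S d)) * INR (fact (S d)))
  by now rewrite fact_simpl, mult_INR.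
assert (H := INR_fact_neq_0 (S d)). assert (H' := INR_S_neq0 (S d)).
destruct d as [|d].
- cbn [Nat.eqb nested_sum]. rewrite E. simpl. field.
- cbn [Nat.eqb]. replace (S (S (S d)) - 1)%nat with (S (S d)) by lia.
  replace (S (S (S d)) - 2)%nat with (S d) by lia.
  rewrite E. field. now split.
Qed.

Theorem theorem3p1 (b : nat -> R) (hb : bernoulli_second_kind b)
    (n : nat) (hn : (2 <= n)%nat) :
  b n = (-1) ^ n * (1 / INR (fact n)) *
        (1 / INR (n + 1) +
         sum_n_m (fun k => (a_coeff n k - INR n * a_coeff (n - 1) k)
                           / INR (fact k)) 2 n).
Proof.
(* Both sequences are convolution inverses of [ln_coeff], so they coincide. *)
rewrite (PS_mult_inj b (fun k => RInt (binom_poly k) 0 1) ln_coeff);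
  [|unfold ln_coeff; simpl; lra
   |intros k; now rewrite (bernoulli_second_kind_mult b hb), RInt_binom_poly_mult].
destruct n as [|[|m]]; [lia|lia|]. clear hn.
replace (S (S m) - 1)%nat with (S m) by lia.
(* Reindexing by [k = d + 2] makes [d] run from 0 to [m]. *)
rewrite <- !sum_n_m_S.
change (sum_n_m ?f 0 m) with (sum_n f m).
rewrite sum_n_Reals.
rewrite (sum_eq _ (fun d => INR (fact (S m)) * (nested_sum d (S (S m)) / INR (S (S d)))
   - INR (S (S m)) * (INR (fact m) * (nested_sum d (S m) / INR (S (S d)))))).
2: { intros d _. rewrite <- !a_coeffE. unfold Rdiv; ring. }
rewrite minus_sum.
rewrite (sum_eq _ (fun d => (nested_sum d (S (S m)) / INR (S (S d))) * INR (fact (S m))))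
  by (intros; ring).
rewrite (sum_eq (fun d => INR (S (S m)) * _)
  (fun d => (nested_sum d (S m) / INR (S (S d))) * (INR (S (S m)) * INR (fact m))))
  by (intros; ring).
rewrite <- !scal_sum.
assert (H1 := is_RInt_rising (S m) (S m) (le_n _)).
assert (H2 := is_RInt_rising m m (le_n _)).
assert (H3 := is_RInt_binom_poly_reflect (S (S m))).
assert (H4 := is_RInt_scal (V := R_NormedModule) _ _ _
   ((-1) ^ S (S m) / INR (fact (S (S m)))) _
   (is_RInt_minus _ _ _ _ _ _ H1 (is_RInt_scal _ _ _ (INR (S (S m))) _ H2))).
apply (is_RInt_ext _ (fun y => binom_poly (S (S m)) (1 - y))) in H4.
2: { intros y _.
  change ((-1) ^ S (S m) / INR (fact (S (S m)))
    * (rising (S (S m)) y - INR (S (S m)) * rising (S m) y)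
    = binom_poly (S (S m)) (1 - y)).
  apply Rmult_eq_reg_l with (INR (fact (S (S m)))); [|apply INR_fact_neq_0].
  rewrite binom_poly_reflect. field. apply INR_fact_neq_0. }
(* [H3] and [H4] evaluate the same integral of the reflected polynomial, once as the coefficient
   sought and once through rising factorials. *)
rewrite <- (is_RInt_unique _ _ _ _ H3), (is_RInt_unique _ _ _ _ H4).
rewrite tech5.
(* The summand [d = m + 1] of the first sum is the isolated term [1 / (n + 1)]. *)
destruct (nested_sum_diag (S m)) as [Hd _].
match goal with |- scal ?c (minus ?p (scal ?q ?t)) = ?z =>
  change (c * (p - q * t) = z) end.
replace (S (S m) + 1)%nat with (S (S (S m))) by lia.
rewrite <- Hd at 2. field. split; [apply INR_S_neq0|apply INR_fact_neq_0].
Qed.
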